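(* Let $n\ge 2$ be an integer and let $A$ be a Banach algebra with norm $\|\cdot\|$. Then $$\mathcal{P}_n(A)=\Bigl\{\sum_{j=1}^m a_j^n : a_1,\dotsc,a_m\in A,\ m\in\mathbb{N}\Bigr\}$$ and the formula $$\|a\|_{\mathcal{P}_n}=\inf\Bigl\{\sum_{j=1}^m\|a_j\|^n : a=\sum_{j=1}^m a_j^n\Bigr\},$$ for each $a\in\mathcal{P}_n(A)$ (the infimum being over all such representations of $a$ with $m\in\mathbb{N}$ and $a_1,\dotsc,a_m\in A$), defines a norm on $\mathcal{P}_n(A)$ such that $$\|a^n\|_{\mathcal{P}_n}\le\|a\|^n\quad(a\in A)\qquad\text{and}\qquad \|a\|\le\|a\|_{\mathcal{P}_n}\quad(a\in\mathcal{P}_n(A)).$$ Further, the following statements hold. (1) Suppose that $\Phi\colon\mathcal{P}_n(A)\to X$ is a $\|\cdot\|_{\mathcal{P}_n}$-continuous linear map for some Banach space $X$. Then the map $P\colon A\to X$ defined by $P(a)=\Phi(a^n)$ $(a\in A)$ is an orthogonally additive continuous $n$-homogeneous polynomial with $\|P\|=\|\Phi\|$. (2) Suppose that $|||\cdot|||$ is a norm on $\mathcal{P}_n(A)$ with the property that, for each Banach space $Y$, the orthogonally additive continuous $n$-homogeneous polynomials from $A$ into $Y$ are exactly the maps of the form $a\mapsto\Phi(a^n)$ for some $|||\cdot|||$-continuous linear map $\Phi\colon\mathcal{P}_n(A)\to Y$. Then there exist real numbers $M_1,M_2>0$ such that $$M_1\|a\|\le|||a|||\le M_2\|a\|_{\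mathcal{P}_n}\quad(a\in\mathcal{P}_n(A)).$$
   Context: All algebras and linear spaces are complex. For an algebra $A$, $\mathcal{P}_n(A)$ denotes the linear span of the set $\{a^n : a\in A\}$. A map $P\colon E\to Y$ between linear spaces is an $n$-homogeneous polynomial if there is an $n$-linear map $\varphi\colon E^n\to Y$ with $P(x)=\varphi(x,\dotsc,x)$ for all $x\in E$. For a continuous $n$-homogeneous polynomial $P$ between normed spaces, $\|P\|=\sup\{\|P(x)\| : \|x\|\le 1\}$; in (1), $\|\Phi\|$ is the operator norm of $\Phi$ with respect to $\|\cdot\|_{\mathcal{P}_n}$. A map $P\colon A\to Y$ from an algebra $A$ to a linear space $Y$ is orthogonally additive if $P(a+b)=P(a)+P(b)$ whenever $a,b\in A$ satisfy $ab=ba=0$. *)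

(* Defs.v *)
(* The field of complex numbers is R[i], for R : realType. *)
From HB Require Import structures.
From mathcomp Require Import all_boot all_order all_algebra.
From mathcomp Require Import all_classical all_reals all_analysis.
From mathcomp.real_closed Require Import complex.
Set Implicit Arguments.
Unset Strict Implicit.
Unset Printing Implicit Defensive.
Import Order.TTheory GRing.Theory Num.Theory.
Import numFieldNormedType.Exports.
Local Open Scope classical_set_scope.
Local Open Scope ring_scope.

(* Not necessarily unital, hence built on semigroupType and not on algType;
   the product of a and b is written (a * b)%g. *)
HB.mixin Record isBanachAlgebra (K : numFieldType) A
    of CompleteNormedModule K A & Semigroup A := {
  mulgDl : forall a b c : A, ((a + b)%R * c)%g = (a * c)%g + (b * c)%g;
  mulgDr : forall a b c : A, (a * (b + c)%R)%g = (a * b)%g + (a * c)%g;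
  mulgZl : forall (k : K) (a b : A), ((k *: a)%R * b)%g = k *: (a * b)%g;
  mulgZr : forall (k : K) (a b : A), (a * (k *: b)%R)%g = k *: (a * b)%g;
  ler_normMg : forall a b : A, `|(a * b)%g| <= `|a| * `|b|
}.

#[short(type="banachAlgType")]
HB.structure Definition BanachAlgebra (K : numFieldType) :=
  {A of isBanachAlgebra K A & CompleteNormedModule K A & Semigroup A}.

(* Only meaningful for 0 < n, since A need not have a unit; npow a 0 = 0. *)
Definition npow (K : numFieldType) (A : banachAlgType K) (a : A) (n : nat) : A :=
  iterop n *%g a 0.

(* In the library, norms on spaces over R[i] take values in R[i]. *)
Definition rnorm (R : realType) (V : normedModType R[i]) (x : V) : R :=
  complex.Re `|x|.

Definition linspan (K : numFieldType) (V : lmodType K) (S : set V) : set V :=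
  [set x | exists m (c : 'I_m -> K) (v : 'I_m -> V),
     (forall j, S (v j)) /\ x = \sum_j c j *: v j].

Lemma linspan_submod_closed (K : numFieldType) (V : lmodType K) (S : set V) :
  submod_closed [pred x | `[< linspan S x >]].
Proof.
split.
  apply/asboolP; exists 0%N; exists (fun=> 0); exists (fun=> 0).
  by split=> [[]//|]; rewrite big_ord0.
move=> k x y /asboolP[m [c [v [Sv ->]]]] /asboolP[p [d [w [Sw ->]]]].
apply/asboolP.
exists (m + p)%N, (fun i : 'I_(m + p) => match fintype.split i with inl j => k * c j | inr j => d j end).
exists (fun i : 'I_(m + p) => match fintype.split i with inl j => v j | inr j => w j end).
split=> [i|]; first by case: (fintype.split i).
rewrite big_split_ord scaler_sumr /=; congr (_ + _); apply: eq_bigr => i _.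
  by rewrite -[lshift _ _]/(unsplit (inl i)) unsplitK scalerA.
by rewrite -[rshift _ _]/(unsplit (inr i)) unsplitK.
Qed.

Section PowerSpan.
Context (K : numFieldType) (A : banachAlgType K) (n : nat).

Definition powers : set A := [set npow a n | a in [set: A]].

Definition powspan_pred : {pred A} := [pred x | `[< linspan powers x >]].

HB.instance Definition _ :=
  GRing.isSubmodClosed.Build K A powspan_pred (linspan_submod_closed powers).

Record powspan := PowSpan {powspan_val : A; _ : powspan_val \in powspan_pred}.

HB.instance Definition _ := [isSub for powspan_val].
HB.instance Definition _ := [Choice of powspan by <:].
HB.instance Definition _ := [SubChoice_isSubLmodule of powspan by <:].

Lemma npow_powspan (a : A) : npow a n \in powspan_pred.
Proof.
apply/asboolP; exists 1%N; exists (fun=> 1 : K); exists (fun=> npow a n).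
by split=> [_|]; [exists a | rewrite big_ord1 scale1r].
Qed.

Definition powspan_npow (a : A) : powspan := PowSpan (npow_powspan a).

End PowerSpan.
Arguments powers {K} A n.

Definition powspan_norm (R : realType) (A : banachAlgType R[i]) (n : nat)
    (x : powspan A n) : R :=
  inf [set r | exists m (a : 'I_m -> A),
    [/\ (0 < m)%N, powspan_val x = \sum_j npow (a j) n
      & r = \sum_j rnorm (a j) ^+ n]].

Definition is_norm (R : realType) (V : lmodType R[i]) (N : V -> R) : Prop :=
  [/\ forall x, 0 <= N x,
      forall x, N x = 0 -> x = 0,
      forall (k : R[i]) x, N (k *: x) = complex.Re `|k| * N x
    & forall x y, N (x + y) <= N x + N y].

Definition continuous_for_norm (R : realType) (V : lmodType R[i]) (N : V -> R)
    (X : normedModType R[i]) (f : V -> X) : Prop :=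
  forall x (e : R), 0 < e ->
    exists2 d : R, 0 < d & forall y, N (y - x) < d -> rnorm (f y - f x) < e.

(* This is both the operator norm of a linear map and the norm of a homogeneous
   polynomial. It is valued in \bar R because the supremum of an unbounded set
   of reals is 0 in R. *)
Definition supnorm (R : realType) (V : lmodType R[i]) (N : V -> R)
    (X : normedModType R[i]) (f : V -> X) : \bar R :=
  ereal_sup [set (rnorm (f x))%:E | x in [set x | N x <= 1]].

Definition multilinear (K : numFieldType) (E Y : lmodType K) (n : nat)
    (phi : ('I_n -> E) -> Y) : Prop :=
  forall (x : 'I_n -> E) (i : 'I_n), linear (fun t : E => phi (dfwith x i t)).

Definition homogeneous_polynomial (K : numFieldType) (E Y : lmodType K) (n : nat)
    (P : E -> Y) : Prop :=
  exists2 phi : ('I_n -> E) -> Y,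
    multilinear phi & forall x, P x = phi (fun=> x).

Definition orthogonally_additive (K : numFieldType) (A : banachAlgType K)
    (Y : lmodType K) (P : A -> Y) : Prop :=
  forall a b : A, (a * b)%g = 0 -> (b * a)%g = 0 -> P (a + b) = P a + P b.

Definition oa_polynomial (K : numFieldType) (A : banachAlgType K) (n : nat)
    (Y : normedModType K) (P : A -> Y) : Prop :=
  [/\ orthogonally_additive P, continuous P & homogeneous_polynomial n P].

(* Main.v *)
From HB Require Import structures.
Require Import Defs.
From mathcomp Require Import all_boot all_order all_algebra.
From mathcomp Require Import all_classical all_reals all_analysis.
From mathcomp.real_closed Require Import complex.
From mathcomp Require Import ring lra.
Import Order.TTheory GRing.Theory Num.Theory.
Import numFieldNormedType.Exports.
Local Open Scope classical_set_scope.
Local Open Scope ring_scope.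

(** Complex numbers have n-th roots, so a scalar can be absorbed into a power:
    c a^n = (c^(1/n) a)^n.  Hence sums of n-th powers already form the linear
    span, and the same remark makes the infimum of the sums of ||a_j||^n
    homogeneous ([powspan_repZ]).  It is definite because
    ||sum a_j^n|| <= sum ||a_j||^n.

    (1) Any subadditive function on the span that is at most C ||a||^n at a^n
    is at most C times the norm ([powspan_norm_dominates]); applied to
    x |-> ||Phi x|| this gives the equality of norms.  That a |-> Phi(a^n) is a
    homogeneous polynomial needs a multilinear map with values in the domain of
    Phi, while a product x_1 ... x_n need not lie in the span.  The symmetrized
    product does, by the polarization formula ([polarization]), which expresses
    it through n-th powers of the partial sums of the x_i.  The expansion of
    these powers takes place in the unitization of the algebra.  The polarized
    map is bounded on balls, and telescoping turns this into continuity
    ([multilinear_continuous]).  Orthogonal additivity holds because every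
    mixed monomial of (a + b)^n contains ab or ba.

    (2) Write N for the second norm.  The lower bound comes from the polynomial
    a |-> a^n into A itself: the linear map that it provides must be the
    inclusion, so the inclusion is N-continuous.  For the upper bound it is
    enough to find M with N(a^n) <= M ||a||^n ([norm_npow_bounded]).
    If there is none, choose a_k with N(a_k^n) > 16^k ||a_k||^n.  A gliding hump
    ([gliding_hump]), in the style of Sokal's elementary proof of the uniform
    boundedness principle, builds from Hahn-Banach functionals that norm the
    a_k^n an N-continuous linear map f with values in a line of A and with
    ||f(a_k^n)|| at least (3/14) 8^-k N(a_k^n).  Then a |-> f(a^n) is a
    continuous homogeneous polynomial, hence at most C ||a||^n, which is
    contradicted by the growth 2^k.  Taking values in A makes completeness of A
    supply the limit, so that neither a completion of the span nor its dual has
    to be constructed.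

    The Hahn-Banach theorem is proved by minimal sublinear functionals: below
    each sublinear functional Zorn's lemma gives a minimal one, and a minimal
    one is additive ([sublinear_minimal_additive]). *)

Set Implicit Arguments.
Unset Strict Implicit.
Unset Printing Implicit Defensive.

(** * Real-valued norms on complex vector spaces *)
Section Rnorm.
Context (R : realType).

Lemma rnormE (V : normedModType R[i]) (x : V) : `|x| = (rnorm x)%:C%C.
Proof. by rewrite /rnorm RRe_real // normr_real. Qed.

Lemma Re_normE (k : R[i]) : `|k| = (complex.Re `|k|)%:C%C.
Proof. by rewrite RRe_real // normr_real. Qed.

Lemma Re_norm_ge0 (k : R[i]) : 0 <= complex.Re `|k|.
Proof. by rewrite -lecR -Re_normE normr_ge0. Qed.

Lemma Re_norm_real (t : R) : complex.Re `|t%:C%C| = `|t|.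
Proof. by rewrite normc_def /= expr0n addr0 sqrtr_sqr. Qed.

Lemma rnorm_is_norm (V : normedModType R[i]) : is_norm (@rnorm R V).
Proof.
split=> [x|x|k x|x y].
- by rewrite -lecR -rnormE normr_ge0.
- by move=> x0; apply/eqP; rewrite -normr_eq0 rnormE x0.
- by apply: complexI; rewrite -rnormE normrZ rnormE Re_normE rmorphM.
- by rewrite -lecR rmorphD /= -!rnormE ler_normD.
Qed.

Lemma Re_norm_exp (k : R[i]) n : complex.Re `|k ^+ n| = (complex.Re `|k|) ^+ n.
Proof. by apply: complexI; rewrite -Re_normE normrX rmorphXn /= -Re_normE. Qed.

Lemma rnorm_npow (A : banachAlgType R[i]) n (a : A) :
  (0 < n)%N -> rnorm (npow a n) <= rnorm a ^+ n.
Proof.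
case: n => // n _; elim: n => [|n IH]; first by rewrite expr1.
rewrite -lecR -rnormE; apply: le_trans (ler_normMg _ _) _.
rewrite !rnormE -rmorphM lecR exprS.
by rewrite ler_wpM2l //; case: (@rnorm_is_norm A).
Qed.

End Rnorm.

Section IsNorm.
Context (R : realType) (V : lmodType R[i]) (N : V -> R).
Hypothesis N_norm : is_norm N.

Lemma is_norm_ge0 x : 0 <= N x. Proof. by case: N_norm. Qed.
Lemma is_norm_eq0 x : N x = 0 -> x = 0. Proof. by case: N_norm => _ + _ _; apply. Qed.
Lemma is_normZ k x : N (k *: x) = complex.Re `|k| * N x. Proof. by case: N_norm. Qed.
Lemma is_normD x y : N (x + y) <= N x + N y. Proof. by case: N_norm. Qed.
Lemma is_norm0 : N 0 = 0.
Proof. by rewrite -(scale0r (0 : V)) is_normZ normr0 mul0r. Qed.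
Lemma is_normN x : N (- x) = N x.
Proof. by rewrite -scaleN1r is_normZ normrN1 mul1r. Qed.
Lemma is_normZ_real (t : R) x : N (t%:C%C *: x) = `|t| * N x.
Proof. by rewrite is_normZ Re_norm_real. Qed.
Lemma is_norm_gt0 x : x != 0 -> 0 < N x.
Proof.
move=> x0; rewrite lt_neqAle is_norm_ge0 andbT eq_sym.
by apply: contra x0 => /eqP /is_norm_eq0 ->.
Qed.
Lemma is_norm_sum (I : Type) (r : seq I) (P : pred I) (F : I -> V) :
  N (\sum_(i <- r | P i) F i) <= \sum_(i <- r | P i) N (F i).
Proof.
elim/big_rec2: _ => [|i y z _ IH]; first by rewrite is_norm0.
by apply: le_trans (is_normD _ _) _; rewrite lerD2l.
Qed.

(** Rescaling any vector into the ball where the map is controlled.  Degree 1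
    gives bounds for continuous linear maps, degree n for polynomials. *)
Lemma homogeneous_bounded (X : normedModType R[i]) (g : V -> X) n (d : R) :
  (0 < n)%N -> (forall k x, g (k *: x) = k ^+ n *: g x) ->
  0 < d -> (forall x, N x < d -> rnorm (g x) < 1) ->
  exists2 C : R, 0 < C & forall x, rnorm (g x) <= C * N x ^+ n.
Proof.
move=> n0 gZ d0 gd; have Xn := @rnorm_is_norm R X.
exists ((2 / d) ^+ n) => [|x]; first by rewrite exprn_gt0 // divr_gt0.
have [->|x0] := eqVneq x 0.
  rewrite -{1}(scale0r (0 : V)) gZ expr0n -(prednK n0) /= scale0r.
  have [_ _ XZ _] := Xn.
  rewrite -{1}(scale0r (0 : X)) XZ normr0 mul0r is_norm0.
  by rewrite expr0n /= mulr0.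
have Nx := is_norm_gt0 x0.
pose t := d / 2 / N x.
have t0 : 0 < t by rewrite !divr_gt0.
have /gd : N (t%:C%C *: x) < d.
  rewrite is_normZ_real gtr0_norm // /t divfK ?gt_eqF //; lra.
rewrite gZ; have [_ _ -> _] := Xn; rewrite Re_norm_exp Re_norm_real gtr0_norm //.
rewrite -exprMn => H; apply: ltW; rewrite -[ltRHS]mul1r.
have -> : 2 / d * N x = t^-1 by rewrite /t; field; rewrite !gt_eqF.
by rewrite exprVn mul1r -[ltRHS]mul1r ltr_pdivlMr ?exprn_gt0 // mulrC.
Qed.

Lemma continuous_for_norm_bounded (X : normedModType R[i]) (f : {linear V -> X}) :
  continuous_for_norm N f -> exists2 C : R, 0 < C & forall x, rnorm (f x) <= C * N x.
Proof.
move=> /(_ 0 1 ltr01) [d d0 fd].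
have [||C C0 fC] := @homogeneous_bounded X f 1 d isT _ d0.
- by move=> k x; rewrite linearZ expr1.
- by move=> x xd; have := fd x; rewrite (linear0 f) !subr0; apply.
by exists C.
Qed.

Lemma bounded_continuous_for_norm (X : normedModType R[i]) (f : {linear V -> X}) C :
  (forall x, rnorm (f x) <= C * N x) -> continuous_for_norm N f.
Proof.
move=> fC x e e0; pose D := Num.max C 1.
have D0 : 0 < D by rewrite lt_max ltr01 orbT.
exists (e / D) => [|y]; first by rewrite divr_gt0.
rewrite ltr_pdivlMr // -raddfB mulrC; apply: le_lt_trans.
by apply: le_trans (fC _) _; rewrite ler_wpM2r ?is_norm_ge0 // le_max lexx.
Qed.

End IsNorm.

Lemma gt0_complexE (R : realType) (e : R[i]) :
  0 < e -> exists2 r : R, 0 < r & e = r%:C%C.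
Proof.
move=> e0; have eE : (complex.Re e)%:C%C = e by rewrite RRe_real // gtr0_real.
by exists (complex.Re e) => //; rewrite -ltcR eE.
Qed.

Lemma continuous_rnormP (R : realType) (E X : normedModType R[i]) (g : E -> X) :
  continuous g <-> forall a (e : R), 0 < e -> exists2 d : R, 0 < d &
    forall y, rnorm (y - a) < d -> rnorm (g y - g a) < e.
Proof.
split=> [cg a e e0|H a].
  have e0' : 0 < e%:C%C :> R[i] by rewrite ltcR.
  have /cvgrPdist_lt/(_ _ e0') := cg a.
  move=> /nbhs_ballP[_ /= /gt0_complexE[d d0 ->] Hd].
  exists d => // y yd; have := Hd y.
  rewrite -ball_normE /= distrC rnormE ltcR distrC rnormE ltcR; exact.
apply/cvgrPdist_lt => _ /gt0_complexE[e e0 ->].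
have [d d0 Hd] := H a e e0.
apply/nbhs_ballP; exists d%:C%C; first by rewrite /= ltcR.
move=> y; rewrite -ball_normE /= distrC rnormE ltcR => /Hd.
by rewrite distrC rnormE ltcR.
Qed.

(** * Polarization *)

Section Polarization.
Context (U : pzRingType) (n : nat).

(** A function e : 'I_n -> bool stands for a subset S of the indices; this is
    the sign (-1)^(n - |S|) of the polarization formula. *)
Definition subset_sign (e : {ffun 'I_n -> bool}) : int := \prod_i (-1) ^+ ~~ e i.

(** Inclusion-exclusion: the sum of the signs of the subsets containing the
    image of f.  It factors over the indices i; the factor is 1 when i is in
    the image, where only membership is possible, and 1 - 1 = 0 otherwise.
    So only surjective, that is injective, maps f survive. *)
Lemma subset_sign_coef (f : {ffun 'I_n -> 'I_n}) :
  \sum_e subset_sign e * (\prod_k (e (f k) : nat))%N%:Z = (injectiveb f)%:Z.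
Proof.
pose c i := #|[pred k | f k == i]|.
(* An index outside the image has the exponent 0, and 0 ^+ 0 = 1. *)
pose G i (b : bool) : int := (-1) ^+ (~~ b) * (Posz b) ^+ c i.
transitivity (\sum_(e : {ffun 'I_n -> bool}) \prod_i G i (e i)).
  apply: eq_bigr => e _; rewrite big_split /=; congr (_ * _).
  rewrite -[LHS]natz natr_prod (partition_big f xpredT) //=.
  apply: eq_bigr => i _; rewrite -prodr_const; apply: eq_big => //= k /eqP ->.
  by rewrite natz.
rewrite -bigA_distr_bigA /=.
have GE i : \sum_b G i b = (c i != 0%N)%:Z.
  by rewrite big_bool /G /= expr1n !mul1r expr1 mulN1r expr0n; case: (c i).
have -> : injectiveb f = [forall i, c i != 0%N].
  apply/injectiveP/forallP => [f_inj i|cf].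
    have := f_inj; move/injF_onto => /(_ i)/codomP[k ik].
    by apply/eqP => /card0_eq/(_ k); rewrite inE ik eqxx.
  have /image_injP f_inj : #|[seq f k | k in 'I_n]| == #|'I_n|.
    apply/eqP/eq_card => i; have [k <-] : exists k, f k = i.
      by have := cf i; rewrite -lt0n => /card_gt0P[k /eqP]; exists k.
    by rewrite inE; apply/mapP; exists k => //; rewrite mem_enum.
  by move=> i j; apply: f_inj.
case: (boolP [forall i, _]) => [/forallP cf|]; first by rewrite big1 // => i _; rewrite GE cf.
by rewrite negb_forall => /existsP[i /negPf ci]; rewrite (bigD1 i) //= GE ci mul0r.
Qed.

Lemma polarization (x : 'I_n -> U) :
  \sum_(e : {ffun 'I_n -> bool}) (\sum_i x i *+ e i) ^+ n *~ subset_sign e =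
  \sum_(f : {ffun 'I_n -> 'I_n} | injectiveb f) \prod_k x (f k).
Proof.
transitivity (\sum_(e : {ffun 'I_n -> bool}) \sum_(f : {ffun 'I_n -> 'I_n})
   (\prod_k x (f k)) *~ (subset_sign e * (\prod_k (e (f k) : nat))%N%:Z)).
  apply: eq_bigr => e _.
  have -> (u : U) : u ^+ n = \prod_(k < n) u by rewrite prodr_const card_ord.
  rewrite bigA_distr_bigA /= mulrz_suml; apply: eq_bigr => f _.
  by rewrite prodrMn mulrC mulrzA pmulrn.
rewrite exchange_big /= [RHS]big_mkcond /=; apply: eq_bigr => f _.
by rewrite -mulrz_sumr subset_sign_coef; case: injectiveb; rewrite ?mulr1z ?mulr0z.
Qed.

(** A noncommutative product, seen as a function of a single factor. *)
Lemma prod_slot (k0 : 'I_n) (y : 'I_n -> U) : exists l r, forall g : 'I_n -> U,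
  (forall k, k != k0 -> g k = y k) -> \prod_k g k = l * g k0 * r.
Proof.
have k0i : k0 \in index_enum 'I_n by rewrite mem_index_enum.
have := index_enum_uniq 'I_n; case/splitPr: k0i => p1 p2.
rewrite cat_uniq /= negb_or => /and3P[_ /andP[k01 _] /andP[k02 _]].
exists (\prod_(k <- p1) y k), (\prod_(k <- p2) y k) => g gy.
rewrite big_cat /= big_cons mulrA; congr (_ * _ * _); rewrite big_seq [RHS]big_seq;
  apply: eq_bigr => k kp; apply: gy; apply: contraTneq kp => -> //.
Qed.

End Polarization.

Section Unitization.
Context (K : numFieldType) (A : banachAlgType K).

Lemma mulg0 (a : A) : (a * 0%R)%g = 0.
Proof. by apply: (addrI (a * 0%R)%g); rewrite -mulgDr !addr0. Qed.
Lemma mul0g (a : A) : (0%R * a)%g = 0.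
Proof. by apply: (addrI (0%R * a)%g); rewrite -mulgDl !addr0. Qed.

(** The algebra has no unit, and powers and indexed products of its elements
    are only available in a ring; adjoining a unit provides one. *)
Definition unitization : Type := (A * K)%type.
HB.instance Definition _ := GRing.Zmodule.copy unitization (A * K)%type.

Definition unitization_mul (u v : unitization) : unitization :=
  ((u.1 * v.1)%g + (u.2 *: v.1 + v.2 *: u.1), u.2 * v.2).

Fact unitization_mulA : associative unitization_mul.
Proof.
move=> [a k] [b l] [c m]; congr (_, _) => /=; last by rewrite mulrA.
rewrite !mulgDl !mulgDr !mulgZl !mulgZr !scalerDr !scalerA mulgA -!addrA.
rewrite [m * k]mulrC [m * l]mulrC; congr (_ + _).
by rewrite !addrA [LHS](ACl (3*1*4*2*5*6)).
Qed.
Fact unitization_mul1 : left_id (0, 1) unitization_mul.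
Proof.
by case=> a k; rewrite /unitization_mul /= mul0g add0r scale1r scaler0 addr0 mul1r.
Qed.

Fact unitization_mulr1 : right_id (0, 1) unitization_mul.
Proof.
by case=> a k; rewrite /unitization_mul /= mulg0 add0r scale1r scaler0 add0r mulr1.
Qed.

Fact unitization_mulDl : left_distributive unitization_mul +%R.
Proof.
move=> [a k] [b l] [c m]; congr (_, _) => /=; last by rewrite mulrDl.
by rewrite mulgDl scalerDl scalerDr !addrA [LHS](ACl (1*3*5*2*4*6)).
Qed.
Fact unitization_mulDr : right_distributive unitization_mul +%R.
Proof.
move=> [a k] [b l] [c m]; congr (_, _) => /=; last by rewrite mulrDr.
by rewrite mulgDr scalerDl scalerDr !addrA [LHS](ACl (1*3*5*2*4*6)).
Qed.
HB.instance Definition _ := GRing.Zmodule_isPzRing.Build unitization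
  unitization_mulA unitization_mul1 unitization_mulr1 unitization_mulDl unitization_mulDr.

Definition embed (a : A) : unitization := (a, 0).

Fact embed_is_additive : zmod_morphism embed.
Proof. by move=> a b; congr (_, _); rewrite subr0. Qed.
HB.instance Definition _ :=
  GRing.isZmodMorphism.Build A unitization embed embed_is_additive.

Lemma embed_inj : injective embed.
Proof. by move=> a b []. Qed.

Lemma embed_npow n (a : A) : (0 < n)%N -> embed (npow a n) = embed a ^+ n.
Proof.
case: n => // n _; elim: n => [|n IH]; first by rewrite expr1.
rewrite exprS -IH; congr (_, _) => /=; last by rewrite mul0r.
by rewrite !scale0r !addr0.
Qed.

(** The algebra is an ideal of its unitization. *)
Lemma embed_slot (u v : unitization) :
  exists2 w : A -> A, linear w & forall t, u * embed t * v = embed (w t).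
Proof.
exists (fun t => ((u.1 * t)%g * v.1)%g + u.2 *: (t * v.1)%g +
                 v.2 *: ((u.1 * t)%g + u.2 *: t)).
  move=> c s t; rewrite /= !mulgDr !mulgDl !mulgZr !mulgZl !scalerDr !scalerA.
  rewrite ![_ * c]mulrC mulrA !addrA.
  by rewrite [LHS](ACl (1*3*5*7*2*4*6*8)).
move=> t; congr (_, _) => /=.
  by rewrite scale0r addr0 mulr0 scale0r add0r mulgDl mulgZl.
by rewrite mulr0 mul0r.
Qed.

End Unitization.

Section Polar.
Context (K : numFieldType) (A : banachAlgType K) (n : nat).
Hypothesis n_gt0 : (0 < n)%N.

(** The symmetrized product of the x_i, written as a combination of n-th
    powers so that it visibly belongs to the span. *)
Definition polar (x : 'I_n -> A) : powspan A n :=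
  \sum_(e : {ffun 'I_n -> bool}) powspan_npow n (\sum_i x i *+ e i) *~ subset_sign e.

Lemma embed_polar x : embed (val (polar x)) =
  \sum_(f : {ffun 'I_n -> 'I_n} | injectiveb f) \prod_k embed (x (f k)).
Proof.
rewrite -(polarization (fun i => embed (x i))) !raddf_sum; apply: eq_bigr => e _.
rewrite !raddfMz; congr (_ *~ _).
change (embed (npow (\sum_i x i *+ e i) n) = (\sum_i embed (x i) *+ e i) ^+ n).
rewrite embed_npow // raddf_sum; congr (_ ^+ _).
by apply: eq_bigr => i _; rewrite raddfMn.
Qed.

(** This number is n!. *)
Definition num_injections := #|[pred f : {ffun 'I_n -> 'I_n} | injectiveb f]|.

Lemma num_injections_gt0 : (0 < num_injections)%N.
Proof.
apply/card_gt0P; exists [ffun i => i]; rewrite inE; apply/injectiveP => i j.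
by rewrite !ffunE.
Qed.

Lemma polar_diag (a : A) : polar (fun=> a) = powspan_npow n a *+ num_injections.
Proof.
apply/val_inj/embed_inj; rewrite embed_polar !raddfMn.
transitivity (embed (npow a n) *+ num_injections); last by [].
rewrite embed_npow // sumr_const; congr (_ *+ _).
by rewrite prodr_const card_ord.
Qed.

(** An injective f is a bijection, so each variable x_i occurs in exactly one
    factor of each of the products in [embed_polar]. *)
Lemma polar_multilinear : multilinear polar.
Proof.
move=> x i.
have slot (f : {ffun 'I_n -> 'I_n}) : exists w : A -> A, injectiveb f ->
   linear w /\ forall t, \prod_k embed (dfwith x i t (f k)) = embed (w t).
  case: (boolP (injectiveb f)) => [/injectiveP f_inj|_]; last by exists id.
  have /codomP[k0 fk0] := injF_onto f_inj i.
  have [l [r lr]] := prod_slot k0 (fun k => embed (x (f k))).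
  have [w w_lin wE] := embed_slot l r; exists w => _; split=> // t.
  rewrite (lr (fun k => embed (dfwith x i t (f k)))).
    by rewrite -fk0 dfwithin wE.
  by move=> k kk0; rewrite dfwithout // fk0 (inj_eq f_inj) eq_sym.
have [w Hw] := choice slot.
have polarE t : val (polar (dfwith x i t)) =
    \sum_(f : {ffun 'I_n -> 'I_n} | injectiveb f) w f t.
  apply: embed_inj; rewrite embed_polar raddf_sum.
  by apply: eq_bigr => f /Hw[_ ->].
move=> c s t; apply: val_inj; rewrite linearP /= !polarE scaler_sumr -big_split.
by apply: eq_bigr => f /Hw[-> _].
Qed.

End Polar.

(** * The norm on the span of the n-th powers *)

Section Npow.
Context (K : numFieldType) (A : banachAlgType K).

Lemma npowSS n (a : A) : npow a n.+2 = (a * npow a n.+1)%g.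
Proof. by []. Qed.

Lemma npowZ n (k : K) (a : A) :
  (0 < n)%N -> npow (k *: a) n = k ^+ n *: npow a n.
Proof.
case: n => // n _; elim: n => [|n IH]; first by rewrite expr1.
by rewrite !npowSS IH mulgZl mulgZr scalerA -exprS.
Qed.

Lemma npow_orth n (a b : A) : (a * b)%g = 0 -> (b * a)%g = 0 ->
  (0 < n)%N -> npow (a + b) n = npow a n + npow b n.
Proof.
move=> ab ba; case: n => // n _; elim: n => [//|n IH].
rewrite !npowSS IH mulgDr !mulgDl.
have ann (x y : A) : (x * y)%g = 0 -> (x * npow y n.+1)%g = 0.
  case: n {IH} => [//|n] xy.
  by rewrite npowSS mulgA xy mul0g.
by rewrite (ann a b) // (ann b a) // addr0 add0r.
Qed.

End Npow.

Section PowspanNorm.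
Context (R : realType) (A : banachAlgType R[i]) (n : nat).
Hypothesis n_gt0 : (0 < n)%N.
Let nmA := @rnorm_is_norm R A.

Lemma powspan_valD (x y : powspan A n) :
  powspan_val (x + y) = powspan_val x + powspan_val y.
Proof. by []. Qed.

Lemma powspan_valZ k (x : powspan A n) :
  powspan_val (k *: x) = k *: powspan_val x.
Proof. by []. Qed.

(** The set of the sums whose infimum is [powspan_norm x]. *)
Definition powspan_rep (x : powspan A n) : set R :=
  [set r | exists m (a : 'I_m -> A),
    [/\ (0 < m)%N, powspan_val x = \sum_j npow (a j) n
      & r = \sum_j rnorm (a j) ^+ n]].

Lemma powspan_rep_npow (a : A) : powspan_rep (powspan_npow n a) (rnorm a ^+ n).
Proof. by exists 1%N, (fun=> a); rewrite !big_ord1. Qed.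

Lemma powspan_repD x y r s :
  powspan_rep x r -> powspan_rep y s -> powspan_rep (x + y) (r + s).
Proof.
move=> [m [a [m0 xa ->]]] [p [b [p0 yb ->]]].
exists (m + p)%N,
  (fun i => match fintype.split i with inl j => a j | inr j => b j end).
split; first by rewrite addn_gt0 m0.
  rewrite powspan_valD xa yb big_split_ord.
  congr (_ + _); apply: eq_bigr => i _.
    by rewrite -[lshift _ _]/(unsplit (inl i)) unsplitK.
  by rewrite -[rshift _ _]/(unsplit (inr i)) unsplitK.
rewrite big_split_ord; congr (_ + _); apply: eq_bigr => i _.
  by rewrite -[lshift _ _]/(unsplit (inl i)) unsplitK.
by rewrite -[rshift _ _]/(unsplit (inr i)) unsplitK.
Qed.

Lemma powspan_repZ k x r :
  powspan_rep x r -> powspan_rep (k *: x) (complex.Re `|k| * r).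
Proof.
move=> [m [a [m0 xa ->]]]; pose q : R[i] := n.-root k.
have qk : q ^+ n = k by rewrite rootCK.
exists m, (fun j => q *: a j); split=> //.
  rewrite powspan_valZ xa scaler_sumr; apply: eq_bigr => i _.
  by rewrite npowZ // qk.
rewrite mulr_sumr; apply: eq_bigr => i _.
by rewrite (is_normZ nmA) exprMn -Re_norm_exp qk.
Qed.

Lemma powspan_rep_ge x r : powspan_rep x r -> rnorm (powspan_val x) <= r.
Proof.
move=> [m [a [_ -> ->]]]; apply: le_trans (is_norm_sum nmA _ _ _) _.
by apply: ler_sum => i _; apply: rnorm_npow.
Qed.

Lemma powspan_rep_ex x : exists r, powspan_rep x r.
Proof.
case: x => x xP; have /asboolP[m [c [v [Sv xE]]]] := xP.
have /choice[b bE] : forall j, exists b, npow b n = v j.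
  by move=> j; have [b _ <-] := Sv j; exists b.
have -> : PowSpan xP = \sum_j c j *: powspan_npow n (b j).
  apply: val_inj; rewrite raddf_sum /= xE; apply: eq_bigr => j _.
  by rewrite -bE.
elim/big_ind: _ => [|y z [r yr] [s zs]|j _].
- by exists (rnorm (0 : A) ^+ n), 1%N, (fun=> 0); rewrite !big_ord1 //;
  split=> //; rewrite -(scale0r (0 : A)) npowZ // expr0n -(prednK n_gt0) scale0r.
- by exists (r + s); apply: powspan_repD.
- by eexists; apply: powspan_repZ; apply: powspan_rep_npow.
Qed.

Lemma powspan_rep_has_inf x : has_inf (powspan_rep x).
Proof.
split; first exact: powspan_rep_ex.
exists 0 => r /powspan_rep_ge; apply: le_trans; exact: (is_norm_ge0 nmA).
Qed.

Lemma powspan_norm_le (x : powspan A n) r : powspan_rep x r -> powspan_norm x <= r.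
Proof. by move=> xr; apply: ge_inf => //; case: (powspan_rep_has_inf x). Qed.

Lemma powspan_norm_npow (a : A) : powspan_norm (powspan_npow n a) <= rnorm a ^+ n.
Proof. exact/powspan_norm_le/powspan_rep_npow. Qed.

Lemma powspan_norm_adh (x : powspan A n) (e : R) : 0 < e ->
  exists2 r, powspan_rep x r & r < powspan_norm x + e.
Proof. by move=> e0; apply: inf_adherent => //; apply: powspan_rep_has_inf. Qed.

Lemma powspan_norm_ge (x : powspan A n) : rnorm (powspan_val x) <= powspan_norm x.
Proof.
apply: lb_le_inf; first exact: powspan_rep_ex.
move=> r xr; exact: powspan_rep_ge xr.
Qed.

Lemma powspan_normZ_le k (x : powspan A n) :
  powspan_norm (k *: x) <= complex.Re `|k| * powspan_norm x.
Proof.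
apply/ler_addgt0Pr => e e0.
have k0 : 0 <= complex.Re `|k| := Re_norm_ge0 k.
have [r xr re] := powspan_norm_adh x (divr_gt0 e0 (ltr_wpDl k0 ltr01)).
apply: le_trans (powspan_norm_le (powspan_repZ k xr)) _.
apply: le_trans (ler_wpM2l k0 (ltW re)) _.
rewrite mulrDr lerD2l mulrCA -[leRHS]mulr1 ler_wpM2l ?ltW //.
rewrite ltr_pdivrMr ?ltr_wpDl //; lra.
Qed.

Lemma powspan_norm_is_norm : is_norm (@powspan_norm R A n).
Proof.
have ge0 (x : powspan A n) : 0 <= powspan_norm x.
  by apply: le_trans (powspan_norm_ge x); apply: (is_norm_ge0 nmA).
split=> [//|x x0|k x|x y].
- apply/val_inj/(is_norm_eq0 nmA)/le_anti; rewrite (is_norm_ge0 nmA) andbT -x0.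
  exact: powspan_norm_ge.
- apply/le_anti/andP; split; first exact: powspan_normZ_le.
  have [->|k0] := eqVneq k 0; first by rewrite normr0 mul0r.
  rewrite -{1}[x](scalerK k0).
  have k0' : 0 < complex.Re `|k| by rewrite -ltcR -Re_normE normr_gt0.
  apply: le_trans (ler_wpM2l (ltW k0') (powspan_normZ_le _ _)) _.
  have -> : complex.Re `|k^-1| = (complex.Re `|k|)^-1.
    by apply: complexI; rewrite fmorphV /= -!Re_normE normfV.
  by rewrite mulVKf // gt_eqF.
- apply/ler_addgt0Pr => e e0; have e2 : 0 < e / 2 by lra.
  have [r xr re] := powspan_norm_adh x e2.
  have [s ys se] := powspan_norm_adh y e2.
  apply: le_trans (powspan_norm_le (powspan_repD xr ys)) _; lra.
Qed.

Lemma powspan_sums : linspan (powers A n) =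
    [set x | exists m (a : 'I_m -> A), (0 < m)%N /\ x = \sum_j npow (a j) n].
Proof.
apply/seteqP; split=> x.
  move=> xP; have xP' : x \in powspan_pred (A := A) n by apply/asboolP.
  by have [r [m [a [m0 xE _]]]] := powspan_rep_ex (PowSpan xP'); exists m, a.
move=> [m [a [_ ->]]]; exists m, (fun=> 1), (fun j => npow (a j) n).
split=> [j|]; first by exists (a j).
by apply: eq_bigr => j _; rewrite scale1r.
Qed.

(** C times the norm is the largest subadditive function with this bound at the
    n-th powers, by its very definition as an infimum; this is how every upper estimate
    on the whole span is obtained from an estimate on powers. *)
Lemma powspan_norm_dominates (q : powspan A n -> R) (C : R) : 0 <= C ->
  (forall x y, q (x + y) <= q x + q y) ->
  (forall a, q (powspan_npow n a) <= C * rnorm a ^+ n) ->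
  forall x, q x <= C * powspan_norm x.
Proof.
move=> C0 qD qC x.
have qr r : powspan_rep x r -> q x <= C * r.
  move=> [[|m] [a [m0 xE ->]]]; first by [].
  have -> : x = \sum_j powspan_npow n (a j) by apply: val_inj; rewrite raddf_sum.
  elim: m a {xE m0} => [|m IH] a; first by rewrite !big_ord1.
  by rewrite big_ord_recl [in leRHS]big_ord_recl mulrDr (le_trans (qD _ _)) // lerD.
apply/ler_addgt0Pr => e e0.
have [r xr re] := powspan_norm_adh x (divr_gt0 e0 (ltr_wpDl C0 ltr01)).
apply: le_trans (qr _ xr) _; apply: le_trans (ler_wpM2l C0 (ltW re)) _.
rewrite mulrDr lerD2l mulrCA -[leRHS]mulr1 ler_wpM2l ?ltW //.
rewrite ltr_pdivrMr ?ltr_wpDl //; lra.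
Qed.

End PowspanNorm.

(** * Polynomials induced by linear maps *)

(** The diagonal values at a and b are joined by replacing the copies of a by
    copies of b one coordinate at a time. *)
Lemma multilinear_telescope (K : numFieldType) (E X : lmodType K) n
    (phi : ('I_n -> E) -> X) (a b : E) : multilinear phi ->
  phi (fun=> b) - phi (fun=> a) =
  \sum_(k < n) phi (dfwith (fun i : 'I_n => if (i < k)%N then b else a) k (b - a)).
Proof.
move=> phi_lin; pose z k (i : 'I_n) := if (i < k)%N then b else a.
have -> : (fun=> b) = z n by apply: funext => i; rewrite /z ltn_ord.
have -> : (fun=> a) = z 0%N by apply: funext => i; rewrite /z ltn0.
rewrite -(telescope_sumr (fun k => phi (z k)) (leq0n n)) big_mkord.
apply: eq_bigr => k _.
have z0 : z k = dfwith (z k) k a.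
  apply: funext => i; case: (eqVneq k i) => [<-|ki].
    by rewrite dfwithin /z ltnn.
  by rewrite dfwithout.
have z1 : z k.+1 = dfwith (z k) k b.
  apply: funext => i; case: (eqVneq k i) => [<-|ki].
    by rewrite dfwithin /z ltnSn.
  by rewrite dfwithout // /z ltnS leq_eqVlt eq_sym (negPf ki : (k == i :> nat) = false).
rewrite z1 [in phi (z k)]z0; have := phi_lin (z k) k (-1) a b.
by rewrite !scaleN1r addrC => <-; rewrite addrC.
Qed.

(** In each term of the telescoping sum one coordinate is b - a.  Pulling out
    its size d leaves a vector of norm at most 1, hence a point of the ball of
    radius ||a|| + 1 on which the map is bounded. *)
Lemma multilinear_continuous (R : realType) (E X : normedModType R[i]) n
    (phi : ('I_n -> E) -> X) : multilinear phi ->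
  (forall r : R, exists C : R, forall x,
     (forall i, rnorm (x i) <= r) -> rnorm (phi x) <= C) ->
  continuous (fun a => phi (fun=> a)).
Proof.
move=> phi_lin phi_bnd; have nmE := @rnorm_is_norm R E.
have nmX := @rnorm_is_norm R X.
apply/continuous_rnormP => a e e0.
have [C0 C0P] := phi_bnd (rnorm a + 1).
pose C := `|C0|; have CP x : (forall i, rnorm (x i) <= rnorm a + 1) -> rnorm (phi x) <= C.
  by move=> /C0P /le_trans; apply; rewrite ler_norm.
have C_ge0 : 0 <= C by rewrite /C.
have D0 : 0 < n%:R * C + 1 by rewrite ltr_wpDl // mulr_ge0.
pose d := Num.min 1 (e / (n%:R * C + 1)).
have d0 : 0 < d by rewrite lt_min ltr01 divr_gt0.
exists d => // b bd.
rewrite (multilinear_telescope a b phi_lin).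
apply: (@le_lt_trans _ _ (n%:R * C * d)); last first.
  apply: (@le_lt_trans _ _ (n%:R * C * (e / (n%:R * C + 1)))).
    by rewrite ler_wpM2l ?mulr_ge0 // ge_min lexx orbT.
  by rewrite mulrCA -[ltRHS]mulr1 ltr_pM2l // ltr_pdivrMr // mul1r ltrDl.
apply: le_trans (is_norm_sum nmX _ _ _) _.
rewrite -mulrA mulr_natl -[n in leRHS]card_ord -sumr_const.
apply: ler_sum => k _; pose z (i : 'I_n) := if (i < k)%N then b else a; rewrite -/z.
pose h := (d^-1)%:C%C *: (b - a).
have -> : b - a = d%:C%C *: h.
  by rewrite scalerA -rmorphM divff ?gt_eqF // scale1r.
have -> : phi (dfwith z k (d%:C%C *: h)) = d%:C%C *: phi (dfwith z k h).
  exact: (scalable_linear (phi_lin z k)).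
rewrite (is_normZ_real nmX) gtr0_norm // mulrC; apply: ler_wpM2r; first exact: ltW.
apply: CP => i.
have b_le : rnorm b <= rnorm a + 1.
  rewrite -[b](subrKC a); apply: le_trans (is_normD nmE _ _) _.
  by rewrite lerD2l (le_trans (ltW bd)) // ge_min lexx.
case: (eqVneq k i) => [<-|ki].
  rewrite dfwithin (is_normZ_real nmE) gtr0_norm ?invr_gt0 //.
  apply: (@le_trans _ _ 1); last by rewrite lerDr (is_norm_ge0 nmE).
  by rewrite ler_pdivrMl // mulr1 ltW.
rewrite dfwithout // /z; case: ifP => // _.
by rewrite lerDl.
Qed.

Section LinearToPolynomial.
Context (R : realType) (A : banachAlgType R[i]) (n : nat) (X : normedModType R[i]).
Context (Phi : {linear powspan A n -> X}).
Hypothesis n_gt0 : (0 < n)%N.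
Let nmA := @rnorm_is_norm R A.
Let nmX := @rnorm_is_norm R X.

Lemma powspan_npowZ k (a : A) :
  powspan_npow n (k *: a) = k ^+ n *: powspan_npow n a.
Proof. by apply: val_inj; rewrite /= npowZ. Qed.

Lemma linear_npow_orthogonally_additive :
  orthogonally_additive (fun a => Phi (powspan_npow n a)).
Proof.
move=> a b ab ba; rewrite -raddfD; congr (Phi _); apply: val_inj.
exact: npow_orth.
Qed.

(** The multilinear map is Phi composed with [polar], divided by the number
    of permutations.  On a ball it is a finite combination of values of Phi at
    n-th powers of bounded elements. *)
Lemma linear_npow_oa_polynomial (C : R) :
  (forall x, rnorm (Phi x) <= C * powspan_norm x) ->
  oa_polynomial n (fun a => Phi (powspan_npow n a)).
Proof.
move=> PhiC.
pose q : R[i] := (num_injections n)%:R^-1.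
pose phi (x : 'I_n -> A) : X := q *: Phi (polar x).
have phi_lin : multilinear phi.
  move=> x i c s t; rewrite /phi (polar_multilinear n_gt0 x i) linearP /= scalerDr.
  by rewrite !scalerA mulrC.
have phiE a : Phi (powspan_npow n a) = phi (fun=> a).
  rewrite /phi polar_diag // raddfMn -scaler_nat scalerA mulVf ?scale1r //.
  by rewrite pnatr_eq0 -lt0n num_injections_gt0.
split; first exact: linear_npow_orthogonally_additive; last by exists phi.
rewrite (_ : (fun a => _) = (fun a => phi (fun=> a))); last exact: funext.
apply: multilinear_continuous => // r.
pose M (e : {ffun 'I_n -> bool}) :=
  complex.Re `|(subset_sign e)%:~R : R[i]| * (`|C| * (n%:R * r) ^+ n).
exists (complex.Re `|q| * \sum_e M e) => x xr.
rewrite /phi (is_normZ nmX) ler_wpM2l ?Re_norm_ge0 //.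
rewrite /polar raddf_sum; apply: le_trans (is_norm_sum nmX _ _ _) _.
apply: ler_sum => e _; rewrite raddfMz -scaler_int (is_normZ nmX).
rewrite ler_wpM2l ?Re_norm_ge0 //.
apply: le_trans (PhiC _) _.
have nmP := powspan_norm_is_norm A n_gt0.
apply: (@le_trans _ _ (`|C| * powspan_norm (powspan_npow n (\sum_i x i *+ e i)))).
  by rewrite ler_wpM2r ?(is_norm_ge0 nmP) // ler_norm.
rewrite ler_wpM2l //.
apply: le_trans (powspan_norm_npow n_gt0 _) _.
rewrite lerXn2r ?nnegrE ?(is_norm_ge0 nmA) //.
  by rewrite mulr_ge0 // (le_trans (is_norm_ge0 nmA (x (Ordinal n_gt0)))).
apply: le_trans (is_norm_sum nmA _ _ _) _.
rewrite mulr_natl -[n in leRHS]card_ord -sumr_const; apply: ler_sum => i _.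
case: (e i); rewrite ?mulr1n ?mulr0n ?(is_norm0 nmA) //.
by rewrite (le_trans (is_norm_ge0 nmA (x i))).
Qed.

(** The supremum over n-th powers of elements of the unit ball controls Phi on
    the whole span by [powspan_norm_dominates]. *)
Lemma linear_npow_supnorm :
  supnorm (@rnorm R A) (fun a => Phi (powspan_npow n a)) =
  supnorm (@powspan_norm R A n) Phi.
Proof.
apply/le_anti/andP; split.
  apply: ge_ereal_sup => _ [a /= a1 <-]; apply: ereal_sup_ubound.
  exists (powspan_npow n a) => //=.
  apply: le_trans (powspan_norm_npow n_gt0 _) _.
  by rewrite exprn_ile1 // (is_norm_ge0 nmA).
apply: ge_ereal_sup => _ [x /= x1 <-].
have Sub a : rnorm a <= 1 -> ((rnorm (Phi (powspan_npow n a)))%:E <=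
    supnorm (@rnorm R A) (fun a => Phi (powspan_npow n a)))%E.
  by move=> a1; apply: ereal_sup_ubound; exists a.
case: supnorm Sub => [s||] Sub; [|by rewrite leey|].
  have P0 : Phi (powspan_npow n 0) = 0.
    by rewrite -(scale0r (0 : A)) powspan_npowZ expr0n gtn_eqF // scale0r raddf0.
  have s0 : 0 <= s.
    by have := Sub 0; rewrite (is_norm0 nmA) P0 (is_norm0 nmX) lee_fin; apply.
  rewrite lee_fin.
  have sE a : rnorm (Phi (powspan_npow n a)) <= s * rnorm a ^+ n.
    have [->|a0] := eqVneq a 0.
      by rewrite P0 (is_norm0 nmX) mulr_ge0 // exprn_ge0 // (is_norm_ge0 nmA).
    have Na := is_norm_gt0 nmA a0.
    have := Sub ((rnorm a)^-1%:C%C *: a).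
    rewrite (is_normZ_real nmA) gtr0_norm ?invr_gt0 // mulVf ?gt_eqF // => /(_ (lexx _)).
    rewrite powspan_npowZ linearZ (is_normZ nmX) Re_norm_exp Re_norm_real lee_fin.
    by rewrite gtr0_norm ?invr_gt0 // exprVn mulrC ler_pdivrMr // exprn_gt0.
  apply: (@le_trans _ _ (s * powspan_norm x)); last first.
    by rewrite -[leRHS]mulr1 ler_wpM2l.
  apply: (powspan_norm_dominates n_gt0 s0 (q := fun x => rnorm (Phi x))) => // y z.
  by rewrite raddfD (is_normD nmX).
by have := Sub 0; rewrite (is_norm0 nmA) ler01 leeNy_eq => /(_ isT).
Qed.

End LinearToPolynomial.

(** * The Hahn-Banach theorem by minimal sublinear functionals *)

Section Sublinear.
Context (R : realType) (V : lmodType R[i]).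
Implicit Types (q p : V -> R) (x y : V).

(** Homogeneity is only asked as an inequality, which is what infima preserve;
    [sublinearZ] recovers the equality. *)
Definition sublinear q : Prop :=
  (forall x y, q (x + y) <= q x + q y) /\
  (forall (t : R) x, 0 < t -> q (t%:C%C *: x) <= t * q x).

Lemma sublinear0 q : sublinear q -> q 0 = 0.
Proof.
move=> [qD qZ]; have := qD 0 0; have := qZ 2^-1 0; rewrite addr0 scaler0.
by move=> /(_ ltac:(lra)); lra.
Qed.

Lemma sublinear_opp q x : sublinear q -> - q (- x) <= q x.
Proof.
by move=> qs; have [qD _] := qs; have := qD x (- x); rewrite subrr sublinear0 //; lra.
Qed.

Lemma sublinearZ q (t : R) x : sublinear q -> 0 <= t -> q (t%:C%C *: x) = t * q x.
Proof.
move=> qs; rewrite le_eqVlt => /predU1P[<-|t0].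
  by rewrite scale0r mul0r sublinear0.
have [_ qZ] := qs; apply/le_anti; rewrite qZ //=.
have := qZ t^-1 (t%:C%C *: x); rewrite invr_gt0 => /(_ t0).
by rewrite scalerA -rmorphM mulVf ?gt_eqF // scale1r ler_pdivlMl.
Qed.

Lemma is_norm_sublinear (N : V -> R) : is_norm N -> sublinear N.
Proof.
move=> N_norm; split=> [x y|t x t0]; first exact: is_normD.
by rewrite (is_normZ_real N_norm) gtr0_norm.
Qed.

(** The largest sublinear minorant of q that takes the value - q y at - y. *)
Definition directional q y x : R :=
  inf [set r | exists2 t : R, 0 <= t & r = q (x + t%:C%C *: y) - t * q y].

Lemma directional_has_inf q y x : sublinear q ->
  has_inf [set r | exists2 t : R, 0 <= t & r = q (x + t%:C%C *: y) - t * q y].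
Proof.
move=> qs; split; first by exists (q x), 0; rewrite // scale0r addr0 mul0r subr0.
exists (- q (- x)) => _ [t t0 ->]; have [qD _] := qs.
have := qD (x + t%:C%C *: y) (- x).
by rewrite addrAC subrr add0r sublinearZ //; lra.
Qed.

Lemma directional_le q y x (t : R) : sublinear q -> 0 <= t ->
  directional q y x <= q (x + t%:C%C *: y) - t * q y.
Proof.
move=> qs t0; apply: ge_inf; last by exists t.
by case: (directional_has_inf y x qs).
Qed.

Lemma directional_adh q y x (e : R) : sublinear q -> 0 < e ->
  exists2 t : R, 0 <= t & q (x + t%:C%C *: y) - t * q y < directional q y x + e.
Proof.
move=> qs e0; have [_ [t t0 ->]] := inf_adherent e0 (directional_has_inf y x qs).
by exists t.
Qed.

Lemma directional_sublinear q y : sublinear q -> sublinear (directional q y).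
Proof.
move=> qs; have [qD _] := qs; split=> [x1 x2|s x s0].
  apply/ler_addgt0Pr => e e0; have e2 : 0 < e / 2 by lra.
  have [t1 t10 lt1] := directional_adh y x1 qs e2.
  have [t2 t20 lt2] := directional_adh y x2 qs e2.
  apply: le_trans (directional_le y _ qs (addr_ge0 t10 t20)) _.
  have := qD (x1 + t1%:C%C *: y) (x2 + t2%:C%C *: y).
  rewrite addrACA -scalerDl -rmorphD mulrDl; lra.
apply/ler_addgt0Pr => e e0.
have [t t0 lt] := directional_adh y x qs (divr_gt0 e0 s0).
apply: le_trans (directional_le y _ qs (mulr_ge0 (ltW s0) t0)) _.
rewrite rmorphM -scalerA -scalerDr (sublinearZ _ qs (ltW s0)) -mulrA -mulrBr.
apply: le_trans (ler_wpM2l (ltW s0) (ltW lt)) _.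
by rewrite mulrDr mulrCA divff ?gt_eqF // mulr1.
Qed.

Lemma directional_le_self q y x : sublinear q -> directional q y x <= q x.
Proof.
move=> qs; apply: le_trans (directional_le y x qs (lexx (0 : R))) _.
by rewrite scale0r addr0 mul0r subr0.
Qed.

(** Two elements of the chain are comparable, so near-infima at x and at y can
    both be taken at the smaller of two members, which is subadditive. *)
Lemma sublinear_chain p (C : set (V -> R)) q0 : C q0 ->
  (forall q, C q -> sublinear q /\ forall x, q x <= p x) ->
  (forall q1 q2, C q1 -> C q2 ->
     (forall x, q1 x <= q2 x) \/ (forall x, q2 x <= q1 x)) ->
  let m x := inf [set q x | q in C] in
  sublinear m /\ forall q, C q -> forall x, m x <= q x.
Proof.
move=> Cq0 Cp Ctot m.
have hi x : has_inf [set q x | q in C].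
  split; first by exists (q0 x), q0.
  exists (- p (- x)) => _ [q /Cp[qs qp] <-].
  by apply: le_trans (sublinear_opp x qs); rewrite lerN2.
have m_le q x : C q -> m x <= q x.
  by move=> Cq; apply: ge_inf; [case: (hi x)|exists q].
have m_adh x e : 0 < e -> exists2 q, C q & q x < m x + e.
  by move=> e0; have [_ [q Cq <-]] := inf_adherent e0 (hi x); exists q.
split; last by move=> q Cq x; apply: m_le.
split=> [x y|t x t0]; apply/ler_addgt0Pr => e e0.
  have e2 : 0 < e / 2 by lra.
  have [q1 C1 lt1] := m_adh x _ e2; have [q2 C2 lt2] := m_adh y _ e2.
  have [le12|le21] := Ctot _ _ C1 C2.
    have [[qD _] _] := Cp _ C1.
    by have := m_le _ (x + y) C1; have := qD x y; have := le12 y; lra.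
  have [[qD _] _] := Cp _ C2.
  by have := m_le _ (x + y) C2; have := qD x y; have := le21 x; lra.
have [q Cq lt] := m_adh x _ (divr_gt0 e0 t0); have [qs _] := Cp _ Cq.
apply: le_trans (m_le _ _ Cq) _; rewrite (sublinearZ _ qs (ltW t0)).
apply: le_trans (ler_wpM2l (ltW t0) (ltW lt)) _.
by rewrite mulrDr mulrCA divff ?gt_eqF // mulr1.
Qed.

Lemma sublinear_minimal p : sublinear p -> exists q,
  [/\ sublinear q, forall x, q x <= p x
    & forall q', sublinear q' -> (forall x, q' x <= q x) -> forall x, q x <= q' x].
Proof.
move=> ps; pose P (q : V -> R) := sublinear q /\ forall x, q x <= p x.
pose T := {q | P q}.
pose below : rel T := fun s t => `[< forall x, sval t x <= sval s x >].
pose p0 : T := exist P p (conj ps (fun x => lexx (p x))).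
have [|||[q [qs qp]] qmin] := @ZL_preorder T p0 below.
- by move=> t; apply/asboolP.
- move=> r s t /asboolP rs /asboolP st; apply/asboolP => x.
  exact: le_trans (st x) (rs x).
- move=> C Ctot; have [[t0 Ct0]|C0] := pselect (exists t, C t); last first.
    by exists p0 => s Cs; case: C0; exists s.
  pose D := [set sval t | t in C].
  have [|||ms mle] := @sublinear_chain p D (sval t0).
  + by exists t0.
  + by move=> _ [t _ <-]; exact: (svalP t).
  + move=> _ _ [t1 C1 <-] [t2 C2 <-].
    by have [/asboolP|/asboolP] := Ctot _ _ C1 C2; [right|left].
  have mp x : inf [set q x | q in D] <= p x.
    by apply: le_trans (proj2 (svalP t0) x); apply: mle; exists t0.
  exists (exist P _ (conj ms mp)) => s Cs; apply/asboolP => x /=.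
  by apply: mle; exists s.
exists q; split=> // q' q's q'q x.
have q'p y : q' y <= p y by apply: le_trans (qp y).
have /asboolP := qmin (exist P q' (conj q's q'p)) ltac:(apply/asboolP; exact: q'q).
by apply.
Qed.

(** By minimality [directional q y] equals q, and its definition with t = 1
    reads q x <= q (x + y) - q y. *)
Lemma sublinear_minimal_additive q : sublinear q ->
  (forall q', sublinear q' -> (forall x, q' x <= q x) -> forall x, q x <= q' x) ->
  {morph q : x y / x + y}.
Proof.
move=> qs qmin x y; apply/le_anti; have [qD _] := qs; rewrite qD /=.
have := qmin _ (directional_sublinear y qs) (fun x => directional_le_self y x qs) x.
have := directional_le y x qs ler01; rewrite scale1r mul1r; lra.
Qed.

(** A minimal functional below [directional N x0] is at most - N x0 at - x0,
    so it attains the norm of x0. *)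
Lemma real_norming_functional (N : V -> R) x0 : is_norm N ->
  exists f : V -> R, [/\ {morph f : x y / x + y},
    forall (t : R) x, f (t%:C%C *: x) = t * f x,
    forall x, f x <= N x & N x0 <= f x0].
Proof.
move=> N_norm; have Ns := is_norm_sublinear N_norm.
have [f [fs fN fmin]] := sublinear_minimal (directional_sublinear x0 Ns).
have fD := sublinear_minimal_additive fs fmin.
have fopp x : f (- x) = - f x.
  by have := fD x (- x); rewrite subrr sublinear0 //; lra.
exists f; split=> //.
- move=> t x; have [t0|t0] := leP 0 t; first exact: sublinearZ.
  rewrite -[t]opprK rmorphN scaleNr fopp sublinearZ ?mulNr //; lra.
- by move=> x; apply: le_trans (fN x) (directional_le_self _ _ _).
have := le_trans (fN (- x0)) (directional_le x0 (- x0) Ns ler01).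
by rewrite scale1r mul1r addNr sublinear0 // fopp; lra.
Qed.

(** The functional f x - i f (i x) has f as real part.  The constant 2
    comes from |f x| + |f (i x)|. *)
Lemma norming_functional (N : V -> R) x0 : is_norm N ->
  exists g : V -> R[i], [/\ scalar g,
    forall x, complex.Re `|g x| <= 2 * N x & N x0 <= complex.Re `|g x0|].
Proof.
move=> N_norm; have [f [fD fZ fN fx0]] := real_norming_functional x0 N_norm.
have fopp x : f (- x) = - f x.
  have -> : - x = (- 1 : R)%:C%C *: x by rewrite rmorphN1 scaleN1r.
  by rewrite fZ mulN1r.
pose g x : R[i] := (f x +i* (- f ('i%C *: x)))%C.
have gRe x : `|f x| <= complex.Re `|g x|.
  by rewrite -lecR -Re_normE; apply: (normc_ge_Re (g x)).
exists g; split=> [k x y|x|];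
  last by rewrite (le_trans fx0) // (le_trans _ (gRe _)) // ler_norm.
  case: k => a b; have kE z : Complex a b *: z = a%:C%C *: z + b%:C%C *: ('i%C *: z).
    by rewrite scalerA -scalerDl [Complex a b]complexE /= [in LHS]mulrC.
  have ii z : 'i%C *: ('i%C *: z) = - z :> V.
    by rewrite scalerA -expr2 sqr_i scaleN1r.
  rewrite /g scalerDr !fD kE scalerDr !fD !fZ.
  rewrite ![_ *: (_%:C%C *: _)]scalerA ![_ * _%:C%C]mulrC -!scalerA !fZ ii fopp.
  by apply/eqP; rewrite eq_complex /=; apply/andP; split; apply/eqP; ring.
have f_abs z : `|f z| <= N z.
  by rewrite ler_norml fN andbT lerNl -fopp -(is_normN N_norm z) fN.
have gE : g x = (f x)%:C%C + 'i%C * (- f ('i%C *: x))%:C%C by rewrite [LHS]complexE.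
have Ni : N ('i%C *: x) = N x.
  by rewrite (is_normZ N_norm) normc_def /= expr0n expr1n add0r sqrtr1 mul1r.
rewrite -lecR -Re_normE gE; apply: le_trans (ler_normD _ _) _.
have normC t : `|t%:C%C : R[i]| = `|t|%:C%C by rewrite Re_normE Re_norm_real.
have i1 : `|'i%C : R[i]| = 1 by rewrite normc_def /= expr0n expr1n add0r sqrtr1.
rewrite normrM i1 mul1r !normC normrN -rmorphD lecR.
by have := f_abs x; have := f_abs ('i%C *: x); rewrite Ni; lra.
Qed.

End Sublinear.

(** * Gliding hump *)

Section Geometric.
Context (R : realType).
Let rho : R := 8^-1.

Lemma lt_expr2n (B : R) : exists k, B < 2 ^+ k.
Proof.
exists (Num.bound `|B|); apply: le_lt_trans (ler_norm B) _.
apply: lt_trans (archi_boundP (normr_ge0 B)) _.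
by rewrite -natrX ltr_nat ltn_expl.
Qed.

Lemma geometric_small (B t : R) : 0 < t -> exists k, B * rho ^+ k < t.
Proof.
move=> t0; have [k Bk] := lt_expr2n (B / t); exists k.
rewrite exprVn ltr_pdivrMr ?exprn_gt0 // mulrC -ltr_pdivrMr //.
by apply: lt_le_trans Bk _; rewrite lerXn2r ?nnegrE // ler_nat.
Qed.

(** The factor 8/7 is the sum of the powers of 1/8. *)
Lemma geometric_limit (X : completeNormedModType R[i]) (u : nat -> X) (c : R) :
  (forall k, rnorm (u k.+1 - u k) <= c * rho ^+ k) ->
  exists l, forall k, rnorm (l - u k) <= 8 / 7 * c * rho ^+ k.
Proof.
move=> uc; have nmX := @rnorm_is_norm R X.
have c0 : 0 <= c.
  by have := uc 0%N; rewrite expr0 mulr1; apply: le_trans; apply: (is_norm_ge0 nmX).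
have rho_ge0 k : 0 <= rho ^+ k by rewrite exprn_ge0 // /rho; lra.
have ukd k d : rnorm (u (k + d)%N - u k) <= 8 / 7 * c * (rho ^+ k - rho ^+ (k + d)).
  elim: d => [|d IH]; first by rewrite addn0 !subrr mulr0 (is_norm0 nmX).
  rewrite addnS -(subrK (u (k + d)%N) (u (k + d).+1)) -addrA.
  apply: le_trans (is_normD nmX _ _) _; have := uc (k + d)%N; move: IH.
  by rewrite exprS /rho; nra.
have ukj k j : (k <= j)%N -> rnorm (u j - u k) <= 8 / 7 * c * rho ^+ k.
  move=> /subnKC <-; apply: le_trans (ukd _ _) _.
  by rewrite ler_wpM2l ?gerBl //; nra.
have /cauchy_cvg/cvg_ex[l ul] : cauchy (u @ \oo).
  apply: cauchy_exP => _ /gt0_complexE[r r0 ->].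
  have [k kr] := geometric_small (8 / 7 * c) r0.
  exists (u k); exists k => // j /= kj.
  by rewrite -ball_normE /= distrC rnormE ltcR; apply: le_lt_trans (ukj _ _ kj) kr.
exists l => k; apply/ler_addgt0Pr => e e0.
have e0' : 0 < e%:C%C :> R[i] by rewrite ltcR.
have /cvgrPdist_lt/(_ _ e0')[j _ jl] := ul.
have := jl (maxn j k) (leq_maxl _ _); rewrite /= rnormE ltcR => lt.
rewrite -(subrK (u (maxn j k)) l) -addrA; apply: le_trans (is_normD nmX _ _) _.
by rewrite [leRHS]addrC; apply: lerD (ltW lt) _; apply/ukj/leq_maxr.
Qed.

Section Hump.
Context (V : lmodType R[i]) (N : V -> R) (X : completeNormedModType R[i]).
Context (e : X) (h : nat -> V -> R[i]) (x : nat -> V).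
Hypothesis N_norm : is_norm N.
Hypothesis e1 : rnorm e = 1.
Hypothesis h_lin : forall k, scalar (h k).
Hypothesis h_le : forall k v, complex.Re `|h k v| <= 2 * N v.
Hypothesis h_x : forall k, N (x k) <= complex.Re `|h k (x k)|.
Let nmX := @rnorm_is_norm R X.

(** Sokal's choice: the hump 8^-j h_j e is added only if the current map is
    still small at x_j.  Since the hump has norm at least 8^-j N (x_j) there,
    one of the two options has norm at least half of this. *)
Fixpoint hump (k : nat) : V -> X :=
  if k is j.+1 then
    if 2^-1 * rho ^+ j * N (x j) <= rnorm (hump j (x j)) then hump j
    else fun v => hump j v + (rho ^+ j)%:C%C *: (h j v *: e)
  else fun=> 0.

Let rho_gt0 k : 0 < rho ^+ k.
Proof. by rewrite exprn_gt0 // /rho; lra. Qed.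

Lemma rnorm_hump_term k v :
  rnorm ((rho ^+ k)%:C%C *: (h k v *: e)) = rho ^+ k * complex.Re `|h k v|.
Proof. by rewrite (is_normZ_real nmX) (is_normZ nmX) e1 mulr1 gtr0_norm. Qed.

Lemma hump_linear k : linear (hump k).
Proof.
elim: k => [|k IH] c v w /=; first by rewrite scaler0 addr0.
case: ifP => _; first exact: IH.
rewrite IH h_lin scalerDl !scalerDr addrACA; congr (_ + _ + (_ + _)).
by rewrite !scalerA /= mulrA [_ * c]mulrC -!mulrA.
Qed.

Lemma hump_step k v : rnorm (hump k.+1 v - hump k v) <= 2 * N v * rho ^+ k.
Proof.
rewrite /=; case: ifP => _.
  by rewrite subrr (is_norm0 nmX) !mulr_ge0 // ?(is_norm_ge0 N_norm) // ltW.
by rewrite addrAC subrr add0r rnorm_hump_term mulrC ler_wpM2r // ltW.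
Qed.

Lemma hump_x k : 2^-1 * rho ^+ k * N (x k) <= rnorm (hump k.+1 (x k)).
Proof.
rewrite /=; case: ifPn => //; rewrite -ltNge => lt.
set s := (X in rnorm (_ + X)).
have : rnorm s <= rnorm (hump k (x k) + s) + rnorm (hump k (x k)).
  rewrite -[rnorm (hump k (x k))](is_normN nmX).
  by apply: le_trans (is_normD nmX _ _); rewrite addrAC subrr add0r.
have : rho ^+ k * N (x k) <= rnorm s by rewrite rnorm_hump_term ler_wpM2l // ltW.
rewrite -mulrA in lt *; lra.
Qed.

(** After step k the map has norm at least (1/2) 8^-k N (x_k) at x_k, and all
    later humps together change it by at most
    (8/7) 2 8^-(k+1) N (x_k) = (2/7) 8^-k N (x_k).  The difference of the two
    coefficients is 1/2 - 2/7 = 3/14. *)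
Lemma gliding_hump : exists f : {linear V -> X},
  (exists C, forall v, rnorm (f v) <= C * N v) /\
  forall k, 14^-1 * 3 * rho ^+ k * N (x k) <= rnorm (f (x k)).
Proof.
have /choice[f0 fh] : forall v, exists l, forall k,
    rnorm (l - hump k v) <= 8 / 7 * (2 * N v) * rho ^+ k.
  by move=> v; apply: geometric_limit => k; apply: hump_step.
(* The defect of linearity is at most B 8^-k for every k. *)
have f_lin : linear f0.
  move=> c v w; apply/eqP; rewrite -subr_eq0; apply/eqP/(is_norm_eq0 nmX).
  apply/le_anti; rewrite (is_norm_ge0 nmX) andbT leNgt; apply/negP => D0.
  pose B := 8 / 7 * (2 * N (c *: v + w)) +
    (complex.Re `|c| * (8 / 7 * (2 * N v)) + 8 / 7 * (2 * N w)).
  have [k] := geometric_small B D0; apply/negP; rewrite -leNgt.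
  have -> : f0 (c *: v + w) - (c *: f0 v + f0 w) =
     (f0 (c *: v + w) - hump k (c *: v + w)) -
     (c *: (f0 v - hump k v) + (f0 w - hump k w)).
    rewrite (hump_linear k) scalerBr [in RHS](addrACA (c *: f0 v)).
    by rewrite -opprD opprB addrA subrK.
  apply: le_trans (is_normD nmX _ _) _; rewrite (is_normN nmX) /B [leRHS]mulrDl lerD //.
  apply: le_trans (is_normD nmX _ _) _; rewrite [leRHS]mulrDl lerD //.
  rewrite (is_normZ nmX) -[leRHS]mulrA.
  by rewrite ler_wpM2l ?Re_norm_ge0.
pose f : {linear V -> X} := HB.pack f0 (GRing.isLinear.Build _ _ _ _ f0 f_lin).
exists f; split.
  exists (16 / 7) => v; have := fh v 0%N; rewrite /= subr0 expr0 mulr1; lra.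
move=> k; have := hump_x k; have := fh (x k) k.+1; rewrite exprS.
have : rnorm (hump k.+1 (x k)) <= rnorm (f0 (x k)) + rnorm (f0 (x k) - hump k.+1 (x k)).
  rewrite -[X in _ + X](is_normN nmX) opprB.
  by apply: le_trans (is_normD nmX _ _); rewrite addrC subrK.
rewrite /= -/(hump k.+1); set r := rho ^+ k; set n1 := rnorm _; set n2 := rnorm _.
set n3 := rnorm _; rewrite /rho => H1 H2 H3; nra.
Qed.

End Hump.
End Geometric.

(** * Comparison with a norm that linearizes orthogonally additive polynomials *)

Section NormComparison.
Context (R : realType) (A : banachAlgType R[i]) (n : nat).
Hypothesis n_gt0 : (0 < n)%N.
Context (N : powspan A n -> R).
Hypothesis N_norm : is_norm N.
Hypothesis H : forall (Y : completeNormedModType R[i]) (P : A -> Y),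
  oa_polynomial n P <->
  exists2 Phi : {linear powspan A n -> Y},
    continuous_for_norm N Phi & forall a, P a = Phi (powspan_npow n a).
Let nmA := @rnorm_is_norm R A.

Lemma powspan_linear_ext (Y : lmodType R[i]) (f g : {linear powspan A n -> Y}) :
  (forall a, f (powspan_npow n a) = g (powspan_npow n a)) -> f =1 g.
Proof.
move=> fg x; have [r [m [a [_ xE _]]]] := powspan_rep_ex n_gt0 x.
have -> : x = \sum_j powspan_npow n (a j) by apply: val_inj; rewrite raddf_sum.
by rewrite !raddf_sum; apply: eq_bigr => j _; apply: fg.
Qed.

(** The polynomial a |-> a^n into A factors through an N-continuous linear map,
    which agrees with the inclusion on powers, hence everywhere. *)
Lemma norm_dominates_rnorm : exists2 M : R, 0 < M &
  forall x, M * rnorm (powspan_val x) <= N x.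
Proof.
pose incl : {linear powspan A n -> A} := val.
have incl_le x : rnorm (incl x) <= 1 * powspan_norm x.
  by rewrite mul1r; exact: powspan_norm_ge.
have [Phi Phi_cont PhiE] := proj1 (H _) (linear_npow_oa_polynomial n_gt0 incl_le).
have [C C0 PhiC] := continuous_for_norm_bounded N_norm Phi_cont.
exists C^-1 => [|x]; first by rewrite invr_gt0.
by rewrite ler_pdivrMl //; have := PhiC x; rewrite -(powspan_linear_ext PhiE).
Qed.

(** Otherwise a gliding hump along the powers that violate the bound gives a
    polynomial that is continuous but unbounded on the unit ball. *)
Lemma norm_npow_bounded : exists2 M : R, 0 < M &
  forall a, N (powspan_npow n a) <= M * rnorm a ^+ n.
Proof.
apply: contrapT => unb.
have /choice[a a_big] : forall k, exists a,
    16 ^+ k * rnorm a ^+ n < N (powspan_npow n a).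
  move=> k; apply: contrapT => noa; apply: unb; exists (16 ^+ k).
    by rewrite exprn_gt0.
  by move=> a; rewrite leNgt; apply/negP => lt; apply: noa; exists a.
have a_neq0 k : a k != 0.
  apply/eqP => ak; have := a_big k; rewrite ak (is_norm0 nmA).
  rewrite -(scale0r (0 : A)) powspan_npowZ // !expr0n gtn_eqF // scale0r.
  by rewrite (is_norm0 N_norm) mulr0 ltxx.
have a_gt0 k := is_norm_gt0 nmA (a_neq0 k).
pose e := ((rnorm (a 0%N))^-1)%:C%C *: a 0%N.
have e1 : rnorm e = 1.
  by rewrite (is_normZ_real nmA) gtr0_norm ?invr_gt0 // mulVf // gt_eqF.
have /choice[h hP] : forall k, exists g : powspan A n -> R[i], [/\ scalar g,
    forall x, complex.Re `|g x| <= 2 * N x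
    & N (powspan_npow n (a k)) <= complex.Re `|g (powspan_npow n (a k))|].
  by move=> k; apply: norming_functional.
pose x k := powspan_npow n (a k).
have h_lin k : scalar (h k) by case: (hP k).
have h_le k v : complex.Re `|h k v| <= 2 * N v by case: (hP k).
have h_x k : N (x k) <= complex.Re `|h k (x k)| by case: (hP k).
have [f [[B fB] f_big]] := gliding_hump N_norm e1 h_lin h_le h_x.
pose P b := f (powspan_npow n b).
have [_ P_cont _] : oa_polynomial n P.
  by apply/(H P); exists f => //; apply: bounded_continuous_for_norm fB.
have PZ k b : P (k *: b) = k ^+ n *: P b by rewrite /P powspan_npowZ // linearZ.
have P0 : P 0 = 0.
  by have := PZ 0 0; rewrite scale0r expr0n gtn_eqF // scale0r.
have /continuous_rnormP/(_ 0 1 ltr01)[d d0 Pd] := P_cont.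
have [|C C0 PC] := homogeneous_bounded nmA n_gt0 PZ d0.
  by move=> b bd; have := Pd b; rewrite P0 !subr0; apply.
(* 5 exceeds 14/3, so the growth (3/14) 2^k beats the bound C. *)
have [k Ck] := lt_expr2n (5 * C).
have := f_big k; have := PC (a k); have := a_big k; rewrite -/(P _).
set s := rnorm (a k) ^+ n; set N1 := N _; set p := rnorm _.
have s0 : 0 < s by rewrite exprn_gt0.
have r0 : 0 < 8^-1 ^+ k :> R by rewrite exprn_gt0 // invr_gt0.
move=> lt1 le2; rewrite -mulrA => le3.
have : 8^-1 ^+ k * (16 ^+ k * s) < 8^-1 ^+ k * N1 by rewrite ltr_pM2l.
rewrite mulrA -exprMn (_ : 8^-1 * 16 = 2 :> R); last by lra.
have : 5 * C * s < 2 ^+ k * s by rewrite ltr_pM2r.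
have Cs := mulr_gt0 C0 s0; lra.
Qed.

Lemma norm_equivalent_bounds : exists M1 M2 : R,
  [/\ 0 < M1, 0 < M2 & forall x : powspan A n,
    M1 * rnorm (powspan_val x) <= N x <= M2 * powspan_norm x].
Proof.
have [M1 M1_gt0 M1P] := norm_dominates_rnorm.
have [M2 M2_gt0 M2P] := norm_npow_bounded.
exists M1, M2; split=> // x; rewrite M1P /=.
exact: (powspan_norm_dominates n_gt0 (ltW M2_gt0) (is_normD N_norm) M2P).
Qed.

End NormComparison.

Unset Implicit Arguments.

Theorem theorem5p1 (R : realType) (A : banachAlgType R[i]) (n : nat)
    (n_ge2 : (2 <= n)%N) :
  linspan (powers A n) =
    [set x | exists m (a : 'I_m -> A), (0 < m)%N /\ x = \sum_j npow (a j) n] /\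
  is_norm (@powspan_norm R A n) /\
  (forall a : A, powspan_norm (powspan_npow n a) <= rnorm a ^+ n) /\
  (forall a : powspan A n, rnorm (powspan_val a) <= powspan_norm a) /\
  (forall (X : completeNormedModType R[i]) (Phi : {linear powspan A n -> X}),
     continuous_for_norm (@powspan_norm R A n) Phi ->
     let P := fun a : A => Phi (powspan_npow n a) in
     oa_polynomial n P /\
     supnorm (@rnorm R A) P = supnorm (@powspan_norm R A n) Phi) /\
  (forall N : powspan A n -> R,
     is_norm N ->
     (forall (Y : completeNormedModType R[i]) (P : A -> Y),
        oa_polynomial n P <->
        exists2 Phi : {linear powspan A n -> Y},
          continuous_for_norm N Phi & forall a, P a = Phi (powspan_npow n a)) ->
     exists M1 M2 : R,
       [/\ 0 < M1, 0 < M2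
         & forall a : powspan A n,
             M1 * rnorm (powspan_val a) <= N a <= M2 * powspan_norm a]).
Proof.
have n_gt0 : (0 < n)%N by apply: leq_trans n_ge2.
split; first exact: powspan_sums.
split; first exact: powspan_norm_is_norm.
split; first by move=> a; apply: powspan_norm_npow.
split; first by move=> a; apply: powspan_norm_ge.
split=> [X Phi Phi_cont P|N N_norm H]; last exact: norm_equivalent_bounds.
split; last exact: linear_npow_supnorm.
have [C _ PhiC] := continuous_for_norm_bounded (powspan_norm_is_norm A n_gt0) Phi_cont.
exact: linear_npow_oa_polynomial PhiC.
Qed.
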